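(* Let $\Sigma$ be a signature-changing brane ($S\neq\emptyset$) with non-empty Lorentzian part $\Sigma_L$, produced by joining two 5-dimensional anti-de Sitter spaces AdS$_5$ and $\widetilde{\mathrm{AdS}}_5$ (with parameters $\lambda$ and $\tilde\lambda$) preserving the spatial symmetries. Then the total energy density $\varrho$ on the Lorentzian part $\Sigma_L$ of the brane is bounded, $$\frac{\kappa_5^2}{3}\,|\varrho|\le\sqrt{|\tilde\lambda^2-\lambda^2|}\quad\text{on }\Sigma_L,$$ and it vanishes at the set of signature-changing points $S\cap\overline{\Sigma_L}$, i.e. $\varrho(x)\to0$ as $x\in\Sigma_L$ approaches any point of $S\cap\overline{\Sigma_L}$.
   Context: Setting ($n=5$). Let $k\in\{-1,0,1\}$ and let $\lambda,\tilde\lambda\ge0$ be constants (positive if $k\neq1$). $\mathrm{AdS}_n$ carries the metric $$-(k+\lambda^2r^2)dt^2+(k+\lambda^2r^2)^{-1}dr^2+r^2d\Omega^2,$$ with $t\in\mathbb{R}$ and $r>0$ if $k=0,1$, $r>1/\lambda$ if $k=-1$; $d\Omega^2$ is the metric of the $(n-2)$-dimensional Riemannian space $\Upsilon^{n-2}$ of constant curvature $k$. $\widetilde{\mathrm{AdS}}_n$ is the same with $(t,r,\lambda)$ replaced by $(\tilde t,\tilde r,\tilde\lambda)$ and the same $k$. Brane preserving the spatial symmetries: $\Sigma=I\times\Upsilon^{n-2}$, with $I$ an open interval with coordinate $\xi$, and $C^3$ embeddings $\Phi_+(\xi,\varphi)=(t(\xi),r(\xi),\varphi)$ into $\mathrm{AdS}_n$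 and $\Phi_-(\xi,\varphi)=(\tilde t(\xi),\tilde r(\xi),\varphi)$ into $\widetilde{\mathrm{AdS}}_n$, with images $\Sigma^\pm$ (a dot denotes $d/d\xi$). One region $\mathcal{M}^\pm$ with boundary $\Sigma^\pm$ is chosen in each space and the two are matched along $\Sigma$: the first fundamental forms coincide, which means $r(\xi)=\tilde r(\xi)=:a(\xi)$ and $$-(k+\lambda^2a^2)\dot t^2+\frac{\dot a^2}{k+\lambda^2a^2}=-(k+\tilde\lambda^2a^2)\dot{\tilde t}^{\,2}+\frac{\dot a^2}{k+\tilde\lambda^2a^2}=:N(\xi),$$ so that the induced metric on $\Sigma$ is $N(\xi)d\xi^2+a(\xi)^2d\Omega^2$; and there are transverse vector fields (riggings) $\vec\ell_\pm$ along $\Sigma^\pm$, $\vec\ell_+$ pointing towards $\mathcal{M}^+$ and $\vec\ell_-$ pointing outwards from $\mathcal{M}^-$, with equal norms $g^+(\vec\ell_+,\vec\ell_+)=g^-(\vec\ell_-,\vec\ell_-)$ and equal scalar products with corresponding tangent vectors, $g^+(\vec\ell_+,d\Phi_+(v))=g^-(\vec\ell_-,d\Phi_-(v))$ for all $v\in T\Sigma$. Signs: put $\boldsymbol N^+=-\dot a\,dt+\dot t\,dr$ and $\boldsymbol N^-=-\dot a\,d\tilde t+\dot{\tilde t}\,d\tilde r$ (normal one-forms of $\Sigma^\pm$ of equal norm $-N$). Then $\epsilon_1=\mathrm{sign}(\boldsymbol N^+(\vec\ell_+))$ and $\epsilon\in\{1,-1\}$ is the sign with $\boldsymbol N^+(\vec\ell_+)=\epsilon\,\boldsymbol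 N^-(\vec\ell_-)$; both are constant on $\Sigma$. Phases: $\Sigma_L=\{N<0\}$ (Lorentzian part), $\Sigma_E=\{N>0\}$, $\Sigma_0=\{N=0\}$, and $S=(\overline{\Sigma_L}\cap\Sigma_0)\cup(\overline{\Sigma_E}\cap\Sigma_0)$ is the signature-changing set. Energy density: on $\Sigma_L$ the total energy density $\varrho$ is minus the eigenvalue, in the direction of $\partial_\xi$, of the energy-momentum tensor $\tau_{ab}$ of the brane, where $\kappa_n^2\tau_{ab}$ is the delta-supported part of the Einstein tensor of the glued bulk, normalized with the unit normal ($\kappa_n>0$ is the gravitational coupling constant of the bulk). Explicitly, $$\frac{\kappa_n^2}{n-2}\,\varrho=\frac{\epsilon_1}{a\sqrt{-N}}\Big(\epsilon\,(k+\tilde\lambda^2a^2)\,\dot{\tilde t}-(k+\lambda^2a^2)\,\dot t\Big)\qquad\text{on }\Sigma_L .$$ *)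

(* Defs.v *)
From HB Require Import structures.
From mathcomp Require Import all_boot all_order all_algebra.
From mathcomp Require Import all_classical all_reals all_analysis.

Set Implicit Arguments.
Unset Strict Implicit.
Unset Printing Implicit Defensive.

Import Order.TTheory GRing.Theory Num.Theory.
Import numFieldNormedType.Exports.

Local Open Scope classical_set_scope.
Local Open Scope ring_scope.

Section Branes.
Context {R : realType}.

(* Ambient space R^4 of the constant-curvature space below. *)
Definition amb : Type := (R * 'rV[R]_3)%type.
(* (t, r, phi) *)
Definition bulk : Type := (R * R * amb)%type.
(* (xi, phi) *)
Definition wv : Type := (R * amb)%type.

Definition time_of (p : bulk) : R := p.1.1.
Definition radius_of (p : bulk) : R := p.1.2.
Definition ups_of (p : bulk) : amb := p.2.

Definition dot3 (u v : 'rV[R]_3) : R := \sum_(i < 3) u 0 i * v 0 i.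

(* The simply connected 3-space of constant curvature k = 1, 0, -1, realized in
   R x R^3 as the unit sphere, the affine hyperplane y0 = 1, and the upper sheet
   of the hyperboloid y0^2 - |y|^2 = 1 respectively; in all three cases its
   metric is the restriction of k dy0^2 + |dy|^2. *)
Definition Upsilon (k : R) : set amb :=
  [set y | y.1 ^+ 2 + k * dot3 y.2 y.2 = 1 /\ (k != 1 -> 0 < y.1)].

Definition tangent_Ups (k : R) (y v : amb) : Prop :=
  y.1 * v.1 + k * dot3 y.2 v.2 = 0.

Definition metric_Ups (k : R) (v w : amb) : R :=
  k * (v.1 * w.1) + dot3 v.2 w.2.

Definition lapse (k lam r : R) : R := k + lam ^+ 2 * r ^+ 2.

Definition AdS (k lam : R) : set bulk :=
  [set p | [/\ Upsilon k (ups_of p),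
               k != -1 -> 0 < radius_of p
             & k = -1 -> lam^-1 < radius_of p]].

Definition tangent_AdS (k : R) (p v : bulk) : Prop :=
  tangent_Ups k (ups_of p) (ups_of v).

Definition metric_AdS (k lam : R) (p v w : bulk) : R :=
  let r := radius_of p in
  - lapse k lam r * (time_of v * time_of w)
  + (lapse k lam r)^-1 * (radius_of v * radius_of w)
  + r ^+ 2 * metric_Ups k (ups_of v) (ups_of w).

Definition Sigma (k : R) (I : set R) : set wv :=
  [set x | I x.1 /\ Upsilon k x.2].

Definition tangent_Sigma (k : R) (x v : wv) : Prop := tangent_Ups k x.2 v.2.

(* Throughout, primed variables belong to the second anti-de Sitter space;
   derivatives in xi are written with derive1. *)
Definition Phi (t r : R -> R) (x : wv) : bulk := (t x.1, r x.1, x.2).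

Definition dPhi (t r : R -> R) (x v : wv) : bulk :=
  (v.1 * derive1 t x.1, v.1 * derive1 r x.1, v.2).

Definition C3_on (I : set R) (f : R -> R) : Prop :=
  (forall n x, (n < 3)%N -> I x -> derivable (derive1n n f) x 1) /\
  {within I, continuous derive1n 3 f}.

Definition C3_embedding (k lam : R) (I : set R) (t r : R -> R) : Prop :=
  [/\ C3_on I t, C3_on I r,
      forall x, Sigma k I x -> AdS k lam (Phi t r x),
      (* immersion *)
      forall x v, Sigma k I x -> tangent_Sigma k x v ->
        dPhi t r x v = 0 -> v = 0
    & (* injective, with continuous inverse on the image *)
      {in Sigma k I &, injective (Phi t r)} /\
      forall x A, Sigma k I x -> nbhs x A ->
        exists2 B, nbhs (Phi t r x) B &
                   Sigma k I `&` Phi t r @^-1` B `<=` A].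

(* M is a 5-dimensional submanifold with boundary B of AdS, for B an embedded
   hypersurface: away from B it is open in AdS, and near each point of B it
   consists of B together with exactly one of the two sides of B. *)
Definition region_with_boundary (k lam : R) (M B : set bulk) : Prop :=
  [/\ B `<=` M, M `<=` AdS k lam,
      exists2 O, open O & M `\` B = AdS k lam `&` O,
      B `<=` closure (M `\` B) `&` closure (AdS k lam `\` M)
    & forall p, B p -> \forall q \near p, AdS k lam q -> closure M q -> M q].

Definition velocity0 (c : R -> bulk) (v : bulk) : Prop :=
  [/\ is_derive (0 : R) (1 : R) (fun s => time_of (c s)) (time_of v),
      is_derive (0 : R) (1 : R) (fun s => radius_of (c s)) (radius_of v),
      is_derive (0 : R) (1 : R) (fun s => (ups_of (c s)).1) (ups_of v).1
    & is_derive (0 : R) (1 : R) (fun s => (ups_of (c s)).2) (ups_of v).2].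

(* For v not tangent to the boundary of M: v points inwards (resp. outwards)
   when it is the velocity at p of a curve starting (resp. ending) at p in M. *)
Definition points_inwards (M : set bulk) (p v : bulk) : Prop :=
  exists c : R -> bulk, [/\ c 0 = p, velocity0 c v &
    \forall s \near (0 : R), 0 <= s -> M (c s)].

Definition points_outwards (M : set bulk) (p v : bulk) : Prop :=
  exists c : R -> bulk, [/\ c 0 = p, velocity0 c v &
    \forall s \near (0 : R), s <= 0 -> M (c s)].

Definition rigging (k : R) (I : set R) (t r : R -> R) (l : wv -> bulk) : Prop :=
  [/\ {within Sigma k I, continuous l},
      forall x, Sigma k I x -> tangent_AdS k (Phi t r x) (l x)
    & forall x v, Sigma k I x -> tangent_Sigma k x v -> dPhi t r x v <> l x].

Definition first_forms_agree (k lam lam' : R) (I : set R)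
    (t r t' r' : R -> R) : Prop :=
  forall x v w, Sigma k I x -> tangent_Sigma k x v -> tangent_Sigma k x w ->
    metric_AdS k lam (Phi t r x) (dPhi t r x v) (dPhi t r x w) =
    metric_AdS k lam' (Phi t' r' x) (dPhi t' r' x v) (dPhi t' r' x w).

Definition riggings_agree (k lam lam' : R) (I : set R)
    (t r t' r' : R -> R) (l l' : wv -> bulk) : Prop :=
  forall x, Sigma k I x ->
    metric_AdS k lam (Phi t r x) (l x) (l x) =
      metric_AdS k lam' (Phi t' r' x) (l' x) (l' x) /\
    forall v, tangent_Sigma k x v ->
      metric_AdS k lam (Phi t r x) (l x) (dPhi t r x v) =
      metric_AdS k lam' (Phi t' r' x) (l' x) (dPhi t' r' x v).

Record matched_brane (k lam lam' : R) (I : set R) (t r t' r' : R -> R)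
    (Mp Mm : set bulk) (lp lm : wv -> bulk) : Prop := MatchedBrane {
  brane_open : open I;
  brane_itv : is_interval I;
  brane_embp : C3_embedding k lam I t r;
  brane_embm : C3_embedding k lam' I t' r';
  brane_regp : region_with_boundary k lam Mp (Phi t r @` Sigma k I);
  brane_regm : region_with_boundary k lam' Mm (Phi t' r' @` Sigma k I);
  brane_first : first_forms_agree k lam lam' I t r t' r';
  brane_rigp : rigging k I t r lp;
  brane_rigm : rigging k I t' r' lm;
  brane_inw : forall x, Sigma k I x -> points_inwards Mp (Phi t r x) (lp x);
  brane_outw : forall x, Sigma k I x -> points_outwards Mm (Phi t' r' x) (lm x);
  brane_rig : riggings_agree k lam lam' I t r t' r' lp lm }.

(* The normal one-form - a' dt + t' dr of the image of Phi t r. *)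
Definition normal_form (t r : R -> R) (x : wv) (v : bulk) : R :=
  - derive1 r x.1 * time_of v + derive1 t x.1 * radius_of v.

Definition brane_signs (k : R) (I : set R) (t r t' r' : R -> R)
    (lp lm : wv -> bulk) (eps1 eps : R) : Prop :=
  [/\ forall x, Sigma k I x -> eps1 = Num.sg (normal_form t r x (lp x)),
      eps = 1 \/ eps = -1
    & forall x, Sigma k I x ->
        normal_form t r x (lp x) = eps * normal_form t' r' x (lm x)].

(* The component N of the first fundamental form N d\xi^2 + a^2 d\Omega^2. *)
Definition Nxi (k lam : R) (t r : R -> R) (xi : R) : R :=
  - lapse k lam (r xi) * derive1 t xi ^+ 2
  + derive1 r xi ^+ 2 / lapse k lam (r xi).

Section Phases.
Variables (k lam : R) (I : set R) (t r : R -> R).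
Definition Sigma_L : set wv := [set x | Sigma k I x /\ Nxi k lam t r x.1 < 0].
Definition Sigma_E : set wv := [set x | Sigma k I x /\ 0 < Nxi k lam t r x.1].
Definition Sigma_0 : set wv := [set x | Sigma k I x /\ Nxi k lam t r x.1 = 0].
Definition sign_change : set wv :=
  (closure Sigma_L `&` Sigma_0) `|` (closure Sigma_E `&` Sigma_0).
End Phases.

(* Minus the eigenvalue along d/dxi of the energy-momentum tensor tau of the
   brane, where kappa^2 tau is the delta part of the Einstein tensor of the glued
   5-dimensional bulk, normalized with the unit normal. Meaningful on the
   Lorentzian part only, since it divides by sqrt (- N). *)
Definition energy_density (k lam lam' kappa eps1 eps : R)
    (t r t' : R -> R) (x : wv) : R :=
  let a := r x.1 in
  3 / kappa ^+ 2 *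
  (eps1 / (a * Num.sqrt (- Nxi k lam t r x.1)) *
   (eps * lapse k lam' a * derive1 t' x.1 - lapse k lam a * derive1 t x.1)).

End Branes.

Arguments bulk : clear implicits.
Arguments wv : clear implicits.
Arguments amb : clear implicits.

(* Main.v *)
Require Import Defs.
From mathcomp Require Import all_boot all_order all_algebra ring lra.
From mathcomp Require Import all_classical all_reals all_analysis.
Import Order.TTheory GRing.Theory Num.Theory.
Import numFieldNormedType.Exports.
Local Open Scope classical_set_scope.
Local Open Scope ring_scope.

(** Write [E = f t_dot] and [E' = f' t'_dot] for the conserved energies of the two
    embeddings, [f] and [f'] being the lapses.  The first fundamental forms give
    [E^2 = a_dot^2 - N f] and [E'^2 = a_dot^2 - N f'], hence
    [(eps E' - E) (eps E' + E) = - N a^2 (lam'^2 - lam^2)].  At a null point the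
    tangent vector is normal, so the matching of the riggings forces
    [eps E' = E <> 0].  Neither energy vanishes where [N <= 0], and [I] is
    connected, so [eps E'] and [E] have the same sign on the whole Lorentzian part;
    there [|eps E' + E|] dominates both [|eps E' - E|] and [|E|], which gives the
    bound and the limit. *)

Set Implicit Arguments.
Unset Strict Implicit.
Unset Printing Implicit Defensive.

(** * Pointwise geometry of an embedding, then two real-variable lemmas *)

Lemma dot3_0r (R : realType) (u : 'rV[R]_3) : dot3 u 0 = 0.
Proof. by rewrite /dot3 big1// => i _; rewrite mxE mulr0. Qed.

Lemma Upsilon_pole (R : realType) (k : R) : Upsilon k (1, 0).
Proof. by split=> [|_] /=; rewrite ?dot3_0r ?mulr0 ?addr0 ?expr1n. Qed.

Lemma Sigma_fiber (R : realType) (k : R) (I : set R) (xi : R) :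
  I xi -> Sigma k I (xi, (1, 0)).
Proof. by move=> Ixi; split; [|exact: Upsilon_pole]. Qed.

Lemma tangent_Sigma_dxi (R : realType) (k xi : R) :
  tangent_Sigma k (xi, (1, 0)) (1, 0).
Proof. by rewrite /tangent_Sigma/tangent_Ups /= dot3_0r !mulr0 addr0. Qed.

Lemma AdS_gt0 (R : realType) (k lam : R) (p : bulk R) :
  k = -1 \/ k = 0 \/ k = 1 -> 0 <= lam -> (k <> 1 -> 0 < lam) -> AdS k lam p ->
  0 < radius_of p /\ 0 < lapse k lam (radius_of p).
Proof.
rewrite /lapse => hk hlam hpos [_ hr0 hr1].
have [km1|/eqP km1] := eqVneq k (-1).
  have lam0 : 0 < lam by apply: hpos; rewrite km1; lra.
  have lamr := hr1 km1.
  have r0 : 0 < radius_of p by rewrite (lt_trans _ lamr)// invr_gt0.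
  split=> //; have : 1 < lam * radius_of p by rewrite -ltr_pdivrMl// mulr1.
  by rewrite km1 -exprMn; nra.
have r0 : 0 < radius_of p by exact/hr0/eqP.
split=> //; have [k1|k0] : k = 1 \/ k = 0 by case: hk => [//|[]]; tauto.
  by rewrite k1 ltr_wpDr// mulr_ge0 ?sqr_ge0.
have lam0 : 0 < lam by apply: hpos; rewrite k0; lra.
by rewrite k0 add0r mulr_gt0 ?exprn_gt0.
Qed.

Lemma first_forms_agree_radius (R : realType) (k lam lam' : R) (I : set R)
    (t r t' r' : R -> R) (xi : R) :
  first_forms_agree k lam lam' I t r t' r' -> I xi ->
  0 < r xi -> 0 < r' xi -> r xi = r' xi.
Proof.
move=> h Ixi r0 r'0.
(* A unit vector along the fibre at the pole: the two first forms on it are [r ^+ 2] and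
   [r' ^+ 2]. *)
pose v : wv R := (0, (0, delta_mx 0 0)).
have tv : tangent_Sigma k (xi, (1, 0)) v.
  by rewrite /tangent_Sigma/tangent_Ups /= /dot3 mulr0 big1 ?mulr0 ?addr0// => i _;
    rewrite mxE mul0r.
have dv : dot3 v.2.2 v.2.2 = 1 :> R.
  rewrite /dot3 (bigD1 ord0)//= !mxE !eqxx mulr1 big1 ?addr0// => i /negPf i0.
  by rewrite !mxE i0 andbF mulr0.
have := h _ _ _ (Sigma_fiber k Ixi) tv tv.
rewrite /metric_AdS/metric_Ups/dPhi/Phi/time_of/radius_of/ups_of /= in dv *.
rewrite dv !(mul0r, mulr0) !add0r !mulr1 => /eqP.
by rewrite eqrXn2 ?ltW// => /eqP.
Qed.

Lemma first_forms_agree_Nxi (R : realType) (k lam lam' : R) (I : set R)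
    (t r t' r' : R -> R) (xi : R) :
  first_forms_agree k lam lam' I t r t' r' -> I xi ->
  Nxi k lam t r xi = Nxi k lam' t' r' xi.
Proof.
move=> h Ixi; pose v : wv R := (1, 0).
have tv : tangent_Sigma k (xi, (1, 0)) v := tangent_Sigma_dxi k xi.
have := h _ _ _ (Sigma_fiber k Ixi) tv tv.
rewrite /metric_AdS/metric_Ups/dPhi/Phi/time_of/radius_of/ups_of /=.
by rewrite dot3_0r !mul1r !(mul0r, mulr0, addr0) /Nxi !expr2 ![_ / lapse _ _ _]mulrC.
Qed.

Lemma C3_embedding_velocity_neq0 (R : realType) (k lam : R) (I : set R)
    (t r : R -> R) (xi : R) :
  C3_embedding k lam I t r -> I xi -> (derive1 t xi, derive1 r xi) != 0.
Proof.
move=> [_ _ _ imm _] Ixi; apply/eqP => -[t0 r0].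
have := imm _ (1, 0) (Sigma_fiber k Ixi) (tangent_Sigma_dxi k xi).
by rewrite /dPhi /= t0 r0 mulr0 => /(_ erefl) [] /eqP; rewrite oner_eq0.
Qed.

(** In the [(t, r)] plane the kernel of the normal form is the line spanned by the velocity, so a
    zero value would make [l x] tangent to the brane. *)
Lemma rigging_normal_form_neq0 (R : realType) (k : R) (I : set R)
    (t r : R -> R) (l : wv R -> bulk R) (x : wv R) :
  rigging k I t r l -> Sigma k I x -> (derive1 t x.1, derive1 r x.1) != 0 ->
  normal_form t r x (l x) != 0.
Proof.
move=> [_ tl trans] Sx v0; apply/eqP; rewrite /normal_form => n0.
have tg c : tangent_Sigma k x (c, ups_of (l x)) by exact: tl.
have [c [hc1 hc2]] : exists c : R, time_of (l x) = c * derive1 t x.1 /\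
    radius_of (l x) = c * derive1 r x.1.
  have [t0|t0] := eqVneq (derive1 t x.1) 0.
    have r0 : derive1 r x.1 != 0 by apply: contra_neq v0; rewrite t0 => ->.
    exists (radius_of (l x) / derive1 r x.1); rewrite divfK//; split=> //.
    rewrite t0 mulr0; move/eqP: n0.
    by rewrite t0 mul0r addr0 mulf_eq0 oppr_eq0 (negPf r0) => /eqP.
  exists (time_of (l x) / derive1 t x.1); rewrite divfK//; split=> //.
  apply: (mulfI t0); rewrite mulrCA mulrA divfK //; lra.
apply: (trans x (c, ups_of (l x))) => //.
rewrite /dPhi /= -hc1 -hc2 /time_of /radius_of /ups_of.
by case: (l x) => -[].
Qed.

(* The intermediate value theorem for [max N P] gives a point where one of [N], [P]
   vanishes and the other is nonpositive. *)
Lemma nonpos_pos_connected (R : realType) (I : set R) (N P : R -> R) :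
  is_interval I -> {in I, continuous N} -> {in I, continuous P} ->
  (forall x, I x -> N x <= 0 -> P x != 0) ->
  (forall x, I x -> N x = 0 -> 0 < P x) ->
  (exists2 y, I y & N y = 0) ->
  forall x, I x -> N x <= 0 -> 0 < P x.
Proof.
move=> itvI cN cP P0 Ppos [y Iy Ny0] x Ix Nx0.
have [//|Px0] := ltP 0 (P x).
pose H z := Num.max (N z) (P z).
have sub (u v : R) : I u -> I v -> `[u, v] `<=` I.
  by move=> Iu Iv z /=; rewrite in_itv /=; exact: itvI.
have cH (u v : R) : I u -> I v -> {within `[u, v], continuous H}.
  move=> Iu Iv; apply: continuous_in_subspaceT => z; rewrite inE => /(sub _ _ Iu Iv) Iz.
  apply: (@continuous2_cvg R R R R (nbhs z) _ N P Num.max (N z) (P z)).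
  - exact: (@max_continuous _ R (N z, P z)).
  - by apply: cN; rewrite inE.
  - by apply: cP; rewrite inE.
have Hx0 : H x <= 0 by rewrite /H ge_max Nx0 Px0.
have Hy0 : 0 <= H y by rewrite /H Ny0 le_max lexx.
have [z Iz Hz0] : exists2 z, I z & H z = 0.
  have [xy|/ltW yx] := leP x y.
    have [||z zI Hz] := @IVT R H x y 0 xy; [exact: cH| |by exists z => //; exact: (sub x y)].
    by rewrite ge_min Hx0 le_max Hy0 orbT.
  have [||z zI Hz] := @IVT R H y x 0 yx; [exact: cH| |by exists z => //; exact: (sub y x)].
  by rewrite ge_min Hx0 le_max Hy0 orbT.
have Nz0 : N z <= 0 by rewrite -Hz0 /H le_max lexx.
have Pz0 : P z <= 0 by rewrite -Hz0 /H le_max lexx orbT.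
have : H z = N z \/ H z = P z by rewrite /H; case: leP => _; [right|left].
(* [N z = 0] would force [0 < P z], against [Pz0]; [P z = 0] is excluded where [N z <= 0]. *)
rewrite Hz0 => -[/esym/(Ppos _ Iz)|/esym Pz].
  by rewrite ltNge Pz0.
by move: (P0 _ Iz Nz0); rewrite Pz eqxx.
Qed.

(** For [E], [G] of the same sign, [|G + E|] dominates both [|G - E|] and [|E|]. Each domination,
    put into [|G - E| * |G + E| = m ^+ 2 * |D|], gives one bound; the second is small when [m]
    is. *)
Lemma ler_norm_sqr_diff (R : rcfType) (E G m D : R) :
  0 < m -> 0 < E * G -> G ^+ 2 - E ^+ 2 = m ^+ 2 * D ->
  `|G - E| / m <= Num.sqrt `|D| /\ `|G - E| / m <= m * `|D| / `|E|.
Proof.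
move=> m0 EG hd.
have E0 : E != 0 by apply: contraTneq EG => ->; rewrite mul0r ltxx.
have prod : `|G - E| * `|G + E| = m ^+ 2 * `|D|.
  by rewrite -normrM -subr_sqr hd normrM ger0_norm// sqr_ge0.
have leE : `|E| <= `|G + E| by rewrite -ler_sqr ?nnegrE// !real_normK ?num_real//; nra.
have leGE : `|G - E| <= `|G + E| by rewrite -ler_sqr ?nnegrE// !real_normK ?num_real//; nra.
split.
  have q0 : 0 <= `|G - E| / m by rewrite divr_ge0// ltW.
  rewrite -(ger0_norm q0) -(sqrtr_sqr (`|G - E| / m)) ler_wsqrtr//.
  rewrite expr_div_n ler_pdivrMr ?exprn_gt0// mulrC -prod expr2.
  exact: ler_wpM2l.
rewrite ler_pdivlMr ?normr_gt0// mulrAC ler_pdivrMr// mulrAC -expr2 -prod.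
exact: ler_wpM2l.
Qed.

(** * The Killing energy of one embedding *)

(** Minus the scalar product of the velocity with the static Killing field [d/dt]. *)
Definition killing_energy (R : realType) (k lam : R) (t r : R -> R) (xi : R) : R :=
  lapse k lam (r xi) * derive1 t xi.

Lemma killing_energy_sqr (R : realType) (k lam : R) (t r : R -> R) (xi : R) :
  lapse k lam (r xi) != 0 ->
  killing_energy k lam t r xi ^+ 2 =
  derive1 r xi ^+ 2 - Nxi k lam t r xi * lapse k lam (r xi).
Proof. by move=> f0; rewrite /killing_energy /Nxi; field. Qed.

(** Zero energy means zero time velocity; then [a_dot^2 = N f <= 0] kills the radial velocity
    too. *)
Lemma killing_energy_neq0 (R : realType) (k lam : R) (t r : R -> R) (xi : R) :
  0 < lapse k lam (r xi) -> (derive1 t xi, derive1 r xi) != 0 ->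
  Nxi k lam t r xi <= 0 -> killing_energy k lam t r xi != 0.
Proof.
move=> f0 v0 N0; apply: contra_neq v0 => E0.
have := killing_energy_sqr t (lt0r_neq0 f0).
move/eqP: (E0); rewrite mulf_eq0 (gt_eqF f0) /= => /eqP ->.
rewrite E0 expr0n /= => h; have /eqP : derive1 r xi ^+ 2 = 0 by nra.
by rewrite sqrf_eq0 => /eqP ->.
Qed.

(* At a null point the tangent vector is itself normal. *)
Lemma null_normal_form (R : realType) (k lam : R) (t r : R -> R) (x : wv R)
    (l : bulk R) :
  lapse k lam (r x.1) != 0 -> Nxi k lam t r x.1 = 0 ->
  derive1 r x.1 * metric_AdS k lam (Phi t r x) l (dPhi t r x (1, 0)) =
  killing_energy k lam t r x.1 * normal_form t r x l.
Proof.
move=> f0 N0; have := killing_energy_sqr t f0.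
rewrite N0 mul0r subr0 /metric_AdS /metric_Ups /normal_form /Phi /dPhi /killing_energy.
rewrite /time_of /radius_of /ups_of /= dot3_0r !(mulr0, addr0, mul1r).
move: (lapse k lam (r x.1)) f0 => f f0 sq.
(* This isolates [derive1 r x.1 ^+ 2], which [sq] turns into [(f * derive1 t x.1) ^+ 2]; the energy
   then factors out. *)
transitivity (- (f * derive1 t x.1 * derive1 r x.1 * l.1.1) +
  f^-1 * (derive1 r x.1 ^+ 2 * l.1.2)); first by ring.
by rewrite -sq; field.
Qed.

(** * The energies of the two sides of a matched brane *)

Section MatchedBrane.
Variables (R : realType) (k lam lam' : R) (I : set R) (t r t' r' : R -> R).
Variables (Mp Mm : set (bulk R)) (lp lm : wv R -> bulk R) (eps1 eps : R).
Hypothesis hk : k = -1 \/ k = 0 \/ k = 1.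
Hypotheses (hlam : 0 <= lam) (hlam' : 0 <= lam').
Hypothesis hpos : k <> 1 -> 0 < lam /\ 0 < lam'.
Hypothesis hbrane : matched_brane k lam lam' I t r t' r' Mp Mm lp lm.
Hypothesis hsigns : brane_signs k I t r t' r' lp lm eps1 eps.

Let E := killing_energy k lam t r.
Let E' := killing_energy k lam' t' r'.
Let N := Nxi k lam t r.

Lemma brane_radius_lapse xi : I xi ->
  [/\ 0 < r xi, 0 < lapse k lam (r xi), 0 < lapse k lam' (r' xi) & r xi = r' xi].
Proof.
case: hbrane => _ _ [_ _ A _ _] [_ _ A' _ _] _ _ hf _ _ _ _ _ Ixi.
have Sxi := Sigma_fiber k Ixi.
have [r0 f0] := AdS_gt0 hk hlam (fun h => (hpos h).1) (A _ Sxi).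
have [r'0 f'0] := AdS_gt0 hk hlam' (fun h => (hpos h).2) (A' _ Sxi).
by split=> //; exact: (first_forms_agree_radius hf).
Qed.

Lemma brane_NxiE xi : I xi -> N xi = Nxi k lam' t' r' xi.
Proof. exact: first_forms_agree_Nxi (brane_first hbrane). Qed.

(** Since [I] is open, the two radii agree on a whole neighbourhood of [xi]. *)
Lemma brane_radius_velocity xi : I xi -> derive1 r xi = derive1 r' xi.
Proof.
move=> Ixi; rewrite !derive1E; apply: near_eq_derive.
have : nbhs xi I by apply: open_nbhs_nbhs; split => //; exact: brane_open hbrane.
by apply: filterS => z /brane_radius_lapse[].
Qed.

Lemma brane_continuous : {in I, continuous r} /\
  [/\ {in I, continuous r'}, {in I, continuous (derive1 r)},
      {in I, continuous (derive1 t)} & {in I, continuous (derive1 t')}].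
Proof.
have C f n : (n < 3)%N -> C3_on I f -> {in I, continuous (derive1n n f)}.
  move=> n3 [Df _] x; rewrite inE => /(Df _ _ n3)/derivable1_diffP.
  exact: differentiable_continuous.
case: hbrane => _ _ [Ct Cr _ _ _] [Ct' Cr' _ _ _] _ _ _ _ _ _ _ _.
split; first exact: (C r 0%N).
by split; [exact: (C r' 0%N)|exact: (C r 1%N)|exact: (C t 1%N)|exact: (C t' 1%N)].
Qed.

Lemma brane_continuous_energies :
  [/\ {in I, continuous N}, {in I, continuous E} & {in I, continuous E'}].
Proof.
have [cr [cr' cdr cdt cdt']] := brane_continuous.
have cl mu (f : R -> R) (z : R) : {for z, continuous f} ->
    {for z, continuous (fun x => k + mu ^+ 2 * f x ^+ 2)}.
  move=> cf; apply: cvgD; first exact: cvg_cst.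
  apply: cvgM; first exact: cvg_cst.
  rewrite (_ : (fun x => _) = (fun x => f x * f x)); last by apply/funext => ?; rewrite expr2.
  exact: cvgM.
split=> z zI; have Iz : I z by rewrite inE in zI.
- have [_ f0 _ _] := brane_radius_lapse Iz.
  rewrite (_ : N = fun x => - lapse k lam (r x) * (derive1 t x * derive1 t x) +
      derive1 r x * derive1 r x / lapse k lam (r x)); last first.
    by apply/funext => x; rewrite /N /Nxi !expr2.
  apply: cvgD; apply: cvgM.
  + by apply: cvgN; apply: cl; exact: cr.
  + by apply: cvgM; exact: cdt.
  + by apply: cvgM; exact: cdr.
  + by apply: cvgV; [exact: lt0r_neq0|apply: cl; exact: cr].
- by apply: cvgM; [apply: cl; exact: cr|exact: cdt].
- by apply: cvgM; [apply: cl; exact: cr'|exact: cdt'].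
Qed.

Lemma brane_killing_energy_neq0 xi : I xi -> N xi <= 0 -> E xi != 0 /\ E' xi != 0.
Proof.
move=> Ixi N0; have [_ f0 f'0 _] := brane_radius_lapse Ixi.
split; apply: killing_energy_neq0 => //.
- exact: C3_embedding_velocity_neq0 (brane_embp hbrane) Ixi.
- exact: C3_embedding_velocity_neq0 (brane_embm hbrane) Ixi.
- by rewrite -brane_NxiE.
Qed.

Lemma brane_eps_sqr : eps ^+ 2 = 1.
Proof. by case: hsigns => _ [] -> _; rewrite ?sqrrN expr1n. Qed.

(** The common scalar product of rigging and velocity, times the common [a_dot], is energy times
    normal form on each side. The normal forms differ by the factor [eps] and are nonzero, so they
    cancel. *)
Lemma null_killing_energy xi : I xi -> N xi = 0 -> eps * E' xi = E xi.
Proof.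
move=> Ixi N0; pose x : wv R := (xi, (1, 0)).
have Sx : Sigma k I x := Sigma_fiber k Ixi.
have [_ f0 f'0 _] := brane_radius_lapse Ixi.
have N'0 : Nxi k lam' t' r' xi = 0 by rewrite -brane_NxiE.
have tv : tangent_Sigma k x (1, 0) := tangent_Sigma_dxi k xi.
have [_ /(_ _ tv) scal] := brane_rig hbrane Sx.
have n'0 : normal_form t' r' x (lm x) != 0.
  apply: (rigging_normal_form_neq0 (brane_rigm hbrane) Sx).
  exact: C3_embedding_velocity_neq0 (brane_embm hbrane) Ixi.
have [_ _ nE] := hsigns.
have := null_normal_form (x := x) (lp x) (lt0r_neq0 f0) N0.
rewrite scal [x.1]/= (brane_radius_velocity Ixi).
rewrite (null_normal_form (x := x) (lm x) (lt0r_neq0 f'0) N'0) nE //.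
rewrite -/(E xi) -/(E' xi) mulrA => /(mulIf n'0) ->.
by rewrite mulrC -mulrA -expr2 brane_eps_sqr mulr1.
Qed.

(** The product is nonzero where [N <= 0] and equals [E ^+ 2] at null points, so its sign propagates
    by connectedness. *)
Lemma brane_killing_energies_pos : (exists2 y, I y & N y = 0) ->
  forall xi, I xi -> N xi <= 0 -> 0 < E xi * (eps * E' xi).
Proof.
have [cN cE cE'] := brane_continuous_energies.
apply: (nonpos_pos_connected (N := N)) => //.
- exact: brane_itv hbrane.
- move=> z zI; apply: cvgM; first exact: cE.
  by apply: cvgM; [exact: cvg_cst|exact: cE'].
- move=> z Iz Nz0; have [E0 E'0] := brane_killing_energy_neq0 Iz Nz0.
  have eps0 : eps != 0 by rewrite -sqrf_eq0 brane_eps_sqr oner_eq0.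
  by apply: mulf_neq0 => //; exact: mulf_neq0.
- move=> z Iz Nz0; have [|E0 _] := brane_killing_energy_neq0 Iz; first by rewrite Nz0.
  by rewrite null_killing_energy// -expr2 exprn_even_gt0.
Qed.

Lemma brane_energy_density_bounds (kappa : R) (x : wv R) : 0 < kappa ->
  (exists2 y, I y & N y = 0) -> Sigma_L k lam I t r x ->
  let rho := energy_density k lam lam' kappa eps1 eps t r t' in
  let D := `|lam' ^+ 2 - lam ^+ 2| in
  kappa ^+ 2 / 3 * `|rho x| <= Num.sqrt D /\
  kappa ^+ 2 / 3 * `|rho x| <= r x.1 * Num.sqrt (- N x.1) * D / `|E x.1|.
Proof.
move=> kappa0 null [Sx N0] rho D; have Ix : I x.1 by case: Sx.
have [r0 f0 f'0 rr'] := brane_radius_lapse Ix.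
have EE'0 := brane_killing_energies_pos null Ix (ltW N0).
set m := r x.1 * Num.sqrt (- N x.1).
have m0 : 0 < m by rewrite mulr_gt0// sqrtr_gt0 oppr_gt0.
(* Both squares share [a_dot^2] and [N], so the difference is [- N (f' - f)], and [k] cancels in
   [f' - f]. *)
have hd : (eps * E' x.1) ^+ 2 - E x.1 ^+ 2 = m ^+ 2 * (lam' ^+ 2 - lam ^+ 2).
  have -> : m ^+ 2 = r x.1 ^+ 2 * - N x.1.
    by rewrite exprMn sqr_sqrtr// oppr_ge0 ltW.
  rewrite exprMn brane_eps_sqr mul1r.
  rewrite !killing_energy_sqr ?lt0r_neq0//.
  rewrite -(brane_NxiE Ix) -(brane_radius_velocity Ix) -rr' /lapse -/N.
  by ring.
(* The left side is [|eps1|] times the right side, and a sign has absolute value at most 1. *)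
suff le : kappa ^+ 2 / 3 * `|rho x| <= `|eps * E' x.1 - E x.1| / m.
  have [le1 le2] := ler_norm_sqr_diff m0 EE'0 hd.
  by split; apply: le_trans le _.
rewrite /rho /energy_density rr' -[eps * _ * _]mulrA -rr' -/(E x.1).
rewrite {2}rr' -/(E' x.1) -/N -/m.
rewrite normrM (ger0_norm (ltW (divr_gt0 _ _))) ?exprn_gt0//.
have kk : kappa ^+ 2 / 3 * (3 / kappa ^+ 2) = 1 by field; rewrite lt0r_neq0.
rewrite (mulrA (kappa ^+ 2 / 3)) kk mul1r normrM mulrC; apply: ler_wpM2l => //.
rewrite normrM normfV (gtr0_norm m0).
rewrite ler_piMl ?invr_ge0 ?(ltW m0)//.
case: hsigns => /(_ _ Sx) -> _ _.
by rewrite normr_sg lern1 leq_b1.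
Qed.

End MatchedBrane.

Unset Implicit Arguments.

(** * The uniform bound, and the limit at signature-changing points *)

Theorem theorem3 (R : realType) (k lam lam' kappa : R)
    (I : set R) (t r t' r' : R -> R)
    (Mp Mm : set (bulk R)) (lp lm : wv R -> bulk R) (eps1 eps : R)
    (hk : k = -1 \/ k = 0 \/ k = 1)
    (hlam : 0 <= lam) (hlam' : 0 <= lam')
    (hpos : k <> 1 -> 0 < lam /\ 0 < lam')
    (hkappa : 0 < kappa)
    (hbrane : matched_brane k lam lam' I t r t' r' Mp Mm lp lm)
    (hsigns : brane_signs k I t r t' r' lp lm eps1 eps)
    (hS : sign_change k lam I t r !=set0)
    (hL : Sigma_L k lam I t r !=set0) :
  let rho := energy_density k lam lam' kappa eps1 eps t r t' in
  (forall x, Sigma_L k lam I t r x ->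
     kappa ^+ 2 / 3 * `|rho x| <= Num.sqrt `|lam' ^+ 2 - lam ^+ 2|) /\
  (forall x, (sign_change k lam I t r `&` closure (Sigma_L k lam I t r)) x ->
     rho y @[y --> within (Sigma_L k lam I t r) (nbhs x)] --> (0 : R)).
Proof.
move=> rho.
(* Both halves of the signature-changing set lie in [Sigma_0], so a point of it supplies the null
   point that the bounds require. *)
have null x : sign_change k lam I t r x -> I x.1 /\ Nxi k lam t r x.1 = 0.
  by case=> -[_ [[]]].
have ex0 : exists2 y, I y & Nxi k lam t r y = 0.
  by case: hS => x /null[]; exists x.1.
have bounds x := brane_energy_density_bounds
  hk hlam hlam' hpos hbrane hsigns (x := x) hkappa ex0.
split=> [x /bounds[]//|x [/null[Ix Nx0] _]].
have xI : x.1 \in I by rewrite inE.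
have [cr _] := brane_continuous hbrane.
have [cN cE _] :=
  brane_continuous_energies hk hlam hlam' hpos hbrane.
have [E0 _] := brane_killing_energy_neq0
  hk hlam hlam' hpos hbrane Ix (eq_ind _ (fun z => z <= 0) (lexx 0) _ (esym Nx0)).
set D := `|lam' ^+ 2 - lam ^+ 2| in bounds.
(* The second bound as a function of [xi] alone: it vanishes at [x.1] through [sqrt (- N)] and is
   continuous there because the energy in the denominator is nonzero. *)
pose h z := 3 / kappa ^+ 2 * (r z * Num.sqrt (- Nxi k lam t r z) * D /
  `|killing_energy k lam t r z|).
have h0 : h x.1 = 0 by rewrite /h Nx0 oppr0 sqrtr0 mulr0 !mul0r mulr0.
have ch : {for x.1, continuous h}.
  apply: cvgM; first exact: cvg_cst.
  apply: cvgM; last first.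
    apply: cvgV; first by rewrite normr_eq0.
    by apply: cvg_norm; exact: cE.
  apply: cvgM; last exact: cvg_cst.
  apply: cvgM; first exact: cr.
  apply: (@continuous_comp _ _ _ (fun z => - Nxi k lam t r z) Num.sqrt).
    by apply: cvgN; exact: cN.
  exact: sqrt_continuous.
(* The limit of [h] is pulled back along the projection to [xi] and restricted to [Sigma_L], where
   [h] dominates [|rho|]. *)
have fstx : (fun y : wv R => y.1) @ nbhs x --> nbhs x.1.
  by case: (x) => u v /=; exact: cvg_fst.
have := cvg_within_filter (Sigma_L k lam I t r) (cvg_comp _ _ fstx ch).
rewrite h0 => cvgh.
apply/norm_cvg0P; apply: (@squeeze_cvgr _ _ _ _ (cst 0) (fun y : wv R => h y.1));
  [|exact: cvg_cst|exact: cvgh].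
rewrite near_withinE; apply: filterE => y Ly; rewrite normr_ge0 /=.
have [_] := bounds _ Ly.
rewrite /h -ler_pdivlMl ?divr_gt0 ?exprn_gt0// invf_div.
exact.
Qed.
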